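(* Let $R$ be a ring with identity and let $a,w,b,c,s,t\in R$ be such that the $(b,s)$-inverse $w^{(b,s)}$ of $w$ and the $(t,c)$-inverse $(aww^{(b,s)})^{(t,c)}$ of $aww^{(b,s)}$ exist. Then the following are equivalent: (i) $aw$ is $(b,c)$-invertible and $(aw)^{(b,c)}=w^{(b,s)}(aww^{(b,s)})^{(t,c)}$; (ii) $b=w^{(b,s)}(aww^{(b,s)})^{(t,c)}awb$.
   Context: Rings are associative with identity, not necessarily commutative. For $b,c\in R$, an element $a\in R$ is called $(b,c)$-invertible if there exists $y\in R$ such that $y\in (bRy)\cap (yRc)$, $yab=b$ and $cay=c$. Such a $y$ is unique when it exists; it is called the $(b,c)$-inverse of $a$ and denoted $a^{(b,c)}$. *)

(* Defs.v *)
From HB Require Import structures.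
From mathcomp Require Import all_boot all_order all_algebra.
From mathcomp Require Import boolp classical_sets.

Set Implicit Arguments.
Unset Strict Implicit.
Unset Printing Implicit Defensive.

Import GRing.Theory.
Local Open Scope ring_scope.

(* Rings are [pzRingType]: noncommutative with identity, and possibly zero. *)

(* The two existentials spell out y \in (b R y) and y \in (y R c). *)
Definition is_bc_inverse (R : pzRingType) (b c a y : R) : Prop :=
  [/\ exists r : R, y = b * r * y,
      exists r : R, y = y * r * c,
      y * a * b = b & c * a * y = c].

Definition bc_invertible (R : pzRingType) (b c a : R) : Prop :=
  exists y : R, is_bc_inverse b c a y.

(* Total version of the (b,c)-inverse of a: by convention 0 when a is not
   (b,c)-invertible; see bc_invP and bc_invE for its meaning otherwise. *)
Definition bc_inv (R : pzRingType) (b c a : R) : R :=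
  xget 0 [set y : R | is_bc_inverse b c a y]%classic.

Lemma is_bc_inverse_uniq (R : pzRingType) (b c a y z : R) :
  is_bc_inverse b c a y -> is_bc_inverse b c a z -> y = z.
Proof.
move=> [_ [r yE] yab _] [[u zE] _ _ caz].
transitivity (y * a * z).
  by rewrite [LHS]yE -caz !mulrA -yE.
by rewrite [in LHS]zE !mulrA yab -zE.
Qed.

Lemma bc_invP (R : pzRingType) (b c a : R) :
  bc_invertible b c a -> is_bc_inverse b c a (bc_inv b c a).
Proof. exact: xgetPex. Qed.

Lemma bc_invE (R : pzRingType) (b c a y : R) :
  is_bc_inverse b c a y -> bc_inv b c a = y.
Proof.
move=> hy; apply: (is_bc_inverse_uniq _ hy).
by apply: bc_invP; exists y.
Qed.

(* Main.v *)
Require Import Defs.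
From HB Require Import structures.
From mathcomp Require Import all_boot all_order all_algebra.

Import GRing.Theory.
Local Open Scope ring_scope.

(** Let [p] and [q] be the two given inverses. Three of the four conditions making [p * q] a
    (b,c)-inverse of [a * w] come for free: [p = b * r * p] and [q = q * u * c] give the two
    memberships, and [c * (a * w * p) * q = c] is the right-hand equation for [q]. The fourth is
    exactly (ii). *)

Theorem theorem2p9 (R : pzRingType) (a w b c s t : R)
  (hw : bc_invertible b s w)
  (haw : bc_invertible t c (a * w * bc_inv b s w)) :
  (bc_invertible b c (a * w) /\
   bc_inv b c (a * w) = bc_inv b s w * bc_inv t c (a * w * bc_inv b s w))
  <->
  b = bc_inv b s w * bc_inv t c (a * w * bc_inv b s w) * a * w * b.
Proof.
case: (bc_invP hw) => -[r pE] _ _ _; case: (bc_invP haw) => _ [u qE] _ cawpq.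
set p := bc_inv b s w in r pE haw u qE cawpq *.
set q := bc_inv t c _ in u qE cawpq *.
split=> [[hinv invE]|bE].
  by have [_ _ yab _] := bc_invP hinv; rewrite -[LHS]yab invE !mulrA.
have hy : is_bc_inverse b c (a * w) (p * q).
  split.
  - by exists r; rewrite mulrA -pE.
  - by exists u; rewrite -!mulrA [q * (u * c)]mulrA -qE.
  - by rewrite mulrA -bE.
  - by rewrite -[RHS]cawpq !mulrA.
(* By uniqueness, the value chosen by [bc_inv] must be [p * q]. *)
by split; [exists (p * q) | exact: bc_invE].
Qed.
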